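(* (1) The category of zero-dimensional proximity spaces with proximity maps is isomorphic to the category of reduced algebras of sets with measurable maps (i.e. maps $f:(X,\mathcal{N})\rightarrow(Y,\mathcal{M})$ such that $f^{-1}(R)\in\mathcal{N}$ whenever $R\in\mathcal{M}$). (2) Their corresponding subcategories of $P_{\aleph_{1}}$-proximity spaces (with proximity maps) and of reduced $\sigma$-algebras (with measurable maps) are isomorphic as well.
   Context: A proximity space is a pair $(X,\delta)$ where $X$ is a set and $\delta$ is a relation on the power set $P(X)$ (with negation $\overline{\delta}$) such that: (1) $A\delta B$ implies $B\delta A$; (2) $(A\cup B)\delta C$ iff $A\delta C$ or $B\delta C$; (3) $A\delta B$ implies $A\neq\emptyset$ and $B\neq\emptyset$; (4) if $A\overline{\delta}B$, then there is a set $E\subseteq X$ with $A\overline{\delta}E$ and $E^{c}\overline{\delta}B$; (5) if $A\cap B\neq\emptyset$, then $A\delta B$. It is separated if $\{x\}\delta\{y\}$ implies $x=y$; all proximity spaces are assumed separated. Here $A^c$ denotes the complement. A function $f:(X,\delta)\to(Y,\rho)$ between proximity spaces is a proximity map if $f(A)\rho f(B)$ whenever $A\delta B$. A proximity space $(X,\delta)$ is zero-dimensional if whenever $A\overline{\delta}B$, there is a $C\subseteq X$ with $A\overline{\delta}C$, $B\overline{\delta}C^{c}$ and $C\overline{\delta}C^{c}$. A separated proximity space $(X,\delta)$ is a $P_{\aleph_{1}}$-proximity space if whenever $A_{n}\subseteq X$ for $n\in\mathbb{N}$, $B\subseteq X$ and $\left(\bigcup_{n}A_{n}\right)\delta B$,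 then $A_{n}\delta B$ for some $n$. Every $P_{\aleph_1}$-proximity space is zero-dimensional. An algebra of sets $(X,\mathcal{M})$ is a set $X$ with a family $\mathcal{M}$ of subsets of $X$ that contains $X$ and is closed under complements and finite unions. It is reduced if whenever $x,y\in X$ are distinct there is $R\in\mathcal{M}$ with $x\in R$, $y\in R^{c}$. The correspondence in question is $(X,\delta)\mapsto(X,\mathcal{M}_{\delta})$ with $\mathcal{M}_{\delta}=\{R\subseteq X \mid R\overline{\delta}R^{c}\}$, and $(X,\mathcal{M})\mapsto(X,\delta_{\mathcal{M}})$ where $U\overline{\delta_{\mathcal{M}}}V$ iff there is some $R\in\mathcal{M}$ with $U\subseteq R$ and $V\subseteq R^{c}$ (identity on underlying functions). *)

(* Defs.v *)
From mathcomp Require Import all_boot.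
From mathcomp Require Import boolp classical_sets.
From mathcomp Require Import measurable_structure.

Set Implicit Arguments.
Unset Strict Implicit.
Unset Printing Implicit Defensive.

Local Open Scope classical_set_scope.

Record category := Category {
  obj :> Type;
  hom : obj -> obj -> Type;
  idm : forall X, hom X X;
  compm : forall X Y Z, hom Y Z -> hom X Y -> hom X Z;
  compm_idl : forall X Y (f : hom X Y), compm (idm Y) f = f;
  compm_idr : forall X Y (f : hom X Y), compm f (idm X) = f;
  compmA : forall X Y Z W (h : hom Z W) (g : hom Y Z) (f : hom X Y),
    compm h (compm g f) = compm (compm h g) f }.

Arguments hom {c} X Y.
Arguments idm {c} X.
Arguments compm {c X Y Z} g f.

Record functor (C D : category) := Functor {
  fobj :> C -> D;
  fmap : forall X Y : C, hom X Y -> hom (fobj X) (fobj Y);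
  fmap_id : forall X : C, fmap (idm X) = idm (fobj X);
  fmap_comp : forall (X Y Z : C) (g : hom Y Z) (f : hom X Y),
    fmap (compm g f) = compm (fmap g) (fmap f) }.

Arguments fmap {C D} f {X Y} _ : rename.

Definition functor_id (C : category) : functor C C :=
  @Functor C C id (fun _ _ f => f) (fun _ => erefl) (fun _ _ _ _ _ => erefl).

Lemma functor_comp_id (C D E : category) (G : functor D E) (F : functor C D)
  (X : C) : fmap G (fmap F (idm X)) = idm (G (F X)).
Proof. by rewrite !fmap_id. Qed.

Lemma functor_comp_comp (C D E : category) (G : functor D E) (F : functor C D)
  (X Y Z : C) (g : hom Y Z) (f : hom X Y) :
  fmap G (fmap F (compm g f)) = compm (fmap G (fmap F g)) (fmap G (fmap F f)).
Proof. by rewrite !fmap_comp. Qed.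

Definition functor_comp (C D E : category) (G : functor D E)
    (F : functor C D) : functor C E :=
  @Functor C E (fun X => G (F X)) (fun _ _ f => fmap G (fmap F f))
    (functor_comp_id G F) (functor_comp_comp G F).

(* Strict isomorphism (not equivalence) of categories: the equalities are
   Leibniz equalities of functors. *)
Definition inverse_functors (C D : category) (F : functor C D)
    (G : functor D C) : Prop :=
  functor_comp G F = functor_id C /\ functor_comp F G = functor_id D.

Definition full_subcategory (C : category) (P : C -> Prop) : category :=
  @Category {X : C | P X} (fun X Y => hom (sval X) (sval Y))
    (fun X => idm (sval X)) (fun _ _ _ g f => compm g f)
    (fun _ _ f => compm_idl f) (fun _ _ f => compm_idr f)
    (fun _ _ _ _ h g f => compmA h g f).

Definition full_subcategory_incl (C : category) (P : C -> Prop) :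
    functor (full_subcategory P) C :=
  @Functor (full_subcategory P) C sval (fun _ _ f => f)
    (fun _ => erefl) (fun _ _ _ _ _ => erefl).

Definition full_subcategory_sub (C : category) (P Q : C -> Prop)
    (PQ : forall X, P X -> Q X) :
    functor (full_subcategory P) (full_subcategory Q) :=
  @Functor (full_subcategory P) (full_subcategory Q)
    (fun X => exist Q (sval X) (PQ _ (svalP X))) (fun _ _ f => f)
    (fun _ => erefl) (fun _ _ _ _ _ => erefl).

Definition function_category : category :=
  @Category Type (fun X Y => X -> Y) (fun _ x => x)
    (fun _ _ _ g f x => g (f x)) (fun _ _ _ => erefl) (fun _ _ _ => erefl)
    (fun _ _ _ _ _ _ _ => erefl).

Section ConcreteCategory.
Variables (Ob : Type) (car : Ob -> Type).
Variable is_mor : forall X Y : Ob, (car X -> car Y) -> Prop.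
Hypothesis is_mor_id : forall X, @is_mor X X (fun x => x).
Hypothesis is_mor_comp : forall X Y Z (g : car Y -> car Z) (f : car X -> car Y),
  is_mor g -> is_mor f -> @is_mor X Z (fun x => g (f x)).

Let chom X Y := {f : car X -> car Y | is_mor f}.

Let cid X : chom X X := exist _ _ (is_mor_id X).

Let ccomp X Y Z (g : chom Y Z) (f : chom X Y) : chom X Z :=
  exist _ _ (is_mor_comp (svalP g) (svalP f)).

Lemma concrete_idl X Y (f : chom X Y) : ccomp (cid Y) f = f.
Proof. by case: f => f fP; congr exist; exact: Prop_irrelevance. Qed.

Lemma concrete_idr X Y (f : chom X Y) : ccomp f (cid X) = f.
Proof. by case: f => f fP; congr exist; exact: Prop_irrelevance. Qed.

Lemma concrete_compA X Y Z W (h : chom Z W) (g : chom Y Z) (f : chom X Y) :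
  ccomp h (ccomp g f) = ccomp (ccomp h g) f.
Proof. by congr exist; exact: Prop_irrelevance. Qed.

Definition concrete_category : category :=
  @Category Ob chom cid ccomp concrete_idl concrete_idr concrete_compA.

Definition forgetful : functor concrete_category function_category :=
  @Functor concrete_category function_category car (fun _ _ f => sval f)
    (fun _ => erefl) (fun _ _ _ _ _ => erefl).

End ConcreteCategory.

Record is_separated_proximity (T : Type) (d : set T -> set T -> Prop) : Prop := {
  prox_sym : forall A B, d A B -> d B A;
  proxU : forall A B C, d (A `|` B) C <-> d A C \/ d B C;
  prox_neq0 : forall A B, d A B -> A <> set0 /\ B <> set0;
  prox_between : forall A B, ~ d A B -> exists E, ~ d A E /\ ~ d (~` E) B;
  prox_meet : forall A B, A `&` B <> set0 -> d A B;
  prox_separated : forall x y, d [set x] [set y] -> x = y }.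

Record proximity_space := ProximitySpace {
  prox_carrier :> Type;
  near_sets : set prox_carrier -> set prox_carrier -> Prop;
  near_sets_axioms : is_separated_proximity near_sets }.

Definition proximity_map (X Y : proximity_space) (f : X -> Y) : Prop :=
  forall A B : set X, near_sets A B -> near_sets (f @` A) (f @` B).

Lemma proximity_map_id (X : proximity_space) :
  @proximity_map X X (fun x => x).
Proof. by move=> A B; rewrite !image_id. Qed.

Lemma proximity_map_comp (X Y Z : proximity_space) (g : Y -> Z) (f : X -> Y) :
  proximity_map g -> proximity_map f ->
  @proximity_map X Z (fun x => g (f x)).
Proof. by move=> gP fP A B /fP /gP; rewrite !image_comp. Qed.

Definition proximity_category : category :=
  concrete_category proximity_map_id proximity_map_comp.

Definition zero_dimensional (X : proximity_space) : Prop :=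
  forall A B : set X, ~ near_sets A B ->
  exists C : set X,
    [/\ ~ near_sets A C, ~ near_sets B (~` C) & ~ near_sets C (~` C)].

Definition P_aleph1 (X : proximity_space) : Prop :=
  forall (A : nat -> set X) (B : set X),
  near_sets (\bigcup_n A n) B -> exists n, near_sets (A n) B.

Record is_algebra_of_sets (T : Type) (M : set (set T)) : Prop := {
  algT : M setT;
  algC : setC_closed M;
  algU : setU_closed M }.

Record algebra_of_sets := AlgebraOfSets {
  alg_carrier :> Type;
  alg_sets : set (set alg_carrier);
  alg_sets_axioms : is_algebra_of_sets alg_sets }.

Definition measurable_map (X Y : algebra_of_sets) (f : X -> Y) : Prop :=
  forall R, alg_sets R -> alg_sets (f @^-1` R).

Lemma measurable_map_id (X : algebra_of_sets) :
  @measurable_map X X (fun x => x).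
Proof. by []. Qed.

Lemma measurable_map_comp (X Y Z : algebra_of_sets) (g : Y -> Z) (f : X -> Y) :
  measurable_map g -> measurable_map f ->
  @measurable_map X Z (fun x => g (f x)).
Proof. by move=> gP fP R /gP /fP. Qed.

Definition algebra_category : category :=
  concrete_category measurable_map_id measurable_map_comp.

Definition reduced (X : algebra_of_sets) : Prop :=
  forall x y : X, x <> y -> exists R, [/\ alg_sets R, R x & (~` R) y].

Definition reduced_sigma (X : algebra_of_sets) : Prop :=
  reduced X /\ sigma_algebra setT (@alg_sets X).

Definition zd_proximity_category : category :=
  @full_subcategory proximity_category zero_dimensional.

Definition P_aleph1_category : category :=
  @full_subcategory proximity_category P_aleph1.

Definition reduced_algebra_category : category :=
  @full_subcategory algebra_category reduced.

Definition reduced_sigma_category : category :=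
  @full_subcategory algebra_category reduced_sigma.

Definition zd_underlying : functor zd_proximity_category function_category :=
  functor_comp (forgetful proximity_map_id proximity_map_comp)
    (@full_subcategory_incl proximity_category zero_dimensional).

Definition ra_underlying : functor reduced_algebra_category function_category :=
  functor_comp (forgetful measurable_map_id measurable_map_comp)
    (@full_subcategory_incl algebra_category reduced).

Definition prox_algebra (X : proximity_space) : set (set X) :=
  [set R | ~ near_sets R (~` R)].

Definition algebra_near (X : algebra_of_sets) (U V : set X) : Prop :=
  ~ exists R, [/\ alg_sets R, U `<=` R & V `<=` ~` R].

(* F is (X, d) |-> (X, M_d) on objects and the identity on functions. *)
Definition is_prox_to_algebra
    (F : functor zd_proximity_category reduced_algebra_category) : Prop :=
  (forall X : zd_proximity_category,
     exists h, sval (F X) = AlgebraOfSets (alg_sets := @prox_algebra (sval X)) h)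
  /\ functor_comp ra_underlying F = zd_underlying.

(* G is (X, M) |-> (X, d_M) on objects and the identity on functions. *)
Definition is_algebra_to_prox
    (G : functor reduced_algebra_category zd_proximity_category) : Prop :=
  (forall X : reduced_algebra_category,
     exists h,
       sval (G X) = ProximitySpace (near_sets := @algebra_near (sval X)) h)
  /\ functor_comp zd_underlying G = ra_underlying.

(* Main.v *)
From mathcomp Require Import all_boot.
From mathcomp Require Import boolp classical_sets.
From mathcomp Require Import measurable_structure.
Require Import Defs.

(** Both passages are inverse to each other already at the level of structures
    on a fixed set. Starting from an algebra [M], a set [R] is far from its
    complement iff some [S] in [M] contains [R] and misses the complement of
    [R], which forces [S = R] ([prox_algebra_algebra_near]). Starting from a
    zero-dimensional proximity, two sets are far iff they are separated by a
    set far from its own complement: this is zero-dimensionality read together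
    with monotonicity of nearness ([algebra_near_prox_algebra]). A function is
    a proximity map iff it is measurable for the associated algebras, so both
    passages are functors acting as the identity on functions.

    For the second part, countable additivity of nearness in the first variable
    is exactly what makes the sets far from their complements stable under
    countable unions ([sigma_algebra_prox_algebra], [P_aleph1_algebra_near]).
    The subcategories make sense because a P_aleph1-proximity is
    zero-dimensional: iterating the interpolation axiom yields an increasing
    chain whose union is far from its complement ([P_aleph1_zero_dimensional]).

    What remains is strict equality of functors. Since the morphisms are
    functions, a functor into one of these categories is determined by its
    values on objects and by its composite with a faithful functor
    ([functor_eq_faithful]). This reduces each equality of functors to an
    equality of objects and to associativity of composition. *)

Set Implicit Arguments.
Unset Strict Implicit.
Unset Printing Implicit Defensive.

Local Open Scope classical_set_scope.

(** * Equality of functors *)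

(** Packing the two components in a sigma type lets equality of functors be
    stated without transporting morphisms along equalities of objects. *)
Definition functor_graph (C D : category) (F : functor C D) :
    {o : C -> D & forall X Y : C, hom X Y -> hom (o X) (o Y)} :=
  existT (fun o : C -> D => forall X Y : C, hom X Y -> hom (o X) (o Y))
    F (fun X Y f => fmap F f).

Lemma functor_graph_inj (C D : category) (F F' : functor C D) :
  functor_graph F = functor_graph F' -> F = F'.
Proof.
case: F F' => [o m mid mcomp] [o' m' mid' mcomp'] FF'.
have oo' : o = o' := projT1_eq FF'.
subst o'.
have := projT2_eq FF'.
rewrite (Prop_irrelevance (projT1_eq FF') erefl) /= => mm'.
have {}mm' : m = m' := mm'.
by subst m'; congr Functor; exact: Prop_irrelevance.
Qed.

Definition faithful (D E : category) (U : functor D E) : Prop :=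
  forall X Y (f g : hom X Y), fmap U f = fmap U g -> f = g.

(** Once the object maps are identified, the action on morphisms can be
    compared after the faithful functor; the equality of composites is then
    one between functors with the same object map, and uniqueness of identity
    proofs removes the transport it carries. *)
Lemma functor_eq_faithful (C D E : category) (U : functor D E)
    (F F' : functor C D) :
  faithful U -> (forall X, F X = F' X) ->
  functor_comp U F = functor_comp U F' -> F = F'.
Proof.
move=> Ufaithful /funext; case: F F' => [o m mid mcomp] [o' m' mid' mcomp'] /=.
move=> oo' UU; subst o'; apply: functor_graph_inj; congr existT.
apply: functional_extensionality_dep => X.
apply: functional_extensionality_dep => Y.
apply: funext => f; apply: Ufaithful.
have gg := congr1 (@functor_graph C E) UU.
have := projT2_eq gg; rewrite (Prop_irrelevance (projT1_eq gg) erefl) /=.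
by move=> /(congr1 (fun h => h X Y f)).
Qed.

Lemma functor_compA (A B C D : category) (H : functor C D) (G : functor B C)
  (F : functor A B) :
  functor_comp H (functor_comp G F) = functor_comp (functor_comp H G) F.
Proof. exact: functor_graph_inj. Qed.

Lemma functor_comp1 (C D : category) (F : functor C D) :
  functor_comp F (functor_id C) = F.
Proof. exact: functor_graph_inj. Qed.

Lemma functor_1comp (C D : category) (F : functor C D) :
  functor_comp (functor_id D) F = F.
Proof. exact: functor_graph_inj. Qed.

Lemma functor_obj_eq (C D : category) (F F' : functor C D) (X : C) :
  F = F' -> F X = F' X.
Proof. by move->. Qed.

(** * Full subcategories and restriction of functors *)

Lemma sval_inj (T : Type) (P : T -> Prop) : injective (@sval T P).
Proof.
by move=> x y; exact: eq_sig_hprop (fun _ => @Prop_irrelevance _) _ _.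
Qed.

Lemma full_subcategory_sub_monic (B C : category) (P Q : C -> Prop)
    (PQ : forall X, P X -> Q X) (F F' : functor B (full_subcategory P)) :
  functor_comp (full_subcategory_sub PQ) F =
    functor_comp (full_subcategory_sub PQ) F' -> F = F'.
Proof.
move=> FF'; apply: (functor_eq_faithful _ _ FF') => // X.
by apply: sval_inj; exact: (congr1 (@sval C Q) (functor_obj_eq X FF')).
Qed.

(** On objects only the membership proof changes, and on morphisms nothing
    does. The square with the inclusions still needs an argument, because
    rebuilding the membership proof yields an object that is equal to
    the value of [F] by proof irrelevance and not by computation. *)
Section Restriction.
Variables (C D : category) (P P' : C -> Prop) (Q Q' : D -> Prop).
Hypotheses (PP' : forall X, P' X -> P X) (QQ' : forall X, Q' X -> Q X).
Let inclP := full_subcategory_sub PP'.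
Let inclQ := full_subcategory_sub QQ'.
Variable F : functor (full_subcategory P) (full_subcategory Q).
Hypothesis FQ' : forall X, P' (sval X) -> Q' (sval (F X)).

Definition restrict_functor :
    functor (full_subcategory P') (full_subcategory Q') :=
  @Functor (full_subcategory P') (full_subcategory Q')
    (fun X => exist Q' (sval (F (inclP X))) (FQ' (X := inclP X) (svalP X)))
    (fun X Y f => @fmap _ _ F (inclP X) (inclP Y) f)
    (fun X => fmap_id F (inclP X))
    (fun X Y Z => @fmap_comp _ _ F (inclP X) (inclP Y) (inclP Z)).

Lemma restrict_functorE :
  functor_comp inclQ restrict_functor = functor_comp F inclP.
Proof.
apply: (@functor_eq_faithful _ _ _ (@full_subcategory_incl D Q)) => //.
- by move=> X; exact: sval_inj.
- exact: functor_graph_inj.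
Qed.

End Restriction.

Lemma restrict_functorK (C D : category) (P P' : C -> Prop) (Q Q' : D -> Prop)
    (PP' : forall X, P' X -> P X) (QQ' : forall X, Q' X -> Q X)
    (F : functor (full_subcategory P) (full_subcategory Q))
    (G : functor (full_subcategory Q) (full_subcategory P))
    (FQ' : forall X, P' (sval X) -> Q' (sval (F X)))
    (GP' : forall X, Q' (sval X) -> P' (sval (G X))) :
  functor_comp G F = functor_id _ ->
  functor_comp (restrict_functor QQ' GP') (restrict_functor PP' FQ') =
    functor_id _.
Proof.
move=> GF; apply: (@full_subcategory_sub_monic _ _ _ _ PP').
rewrite functor_compA restrict_functorE -functor_compA restrict_functorE.
by rewrite functor_compA GF functor_1comp functor_comp1.
Qed.

(** * Zero-dimensional proximities and reduced algebras on a set *)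

Section Proximity.
Variable X : proximity_space.
Implicit Types A B R : set X.

Lemma near_setsS A A' B B' : A `<=` A' -> B `<=` B' ->
  near_sets A B -> near_sets A' B'.
Proof.
have ax := near_sets_axioms X.
have mono (U U' V : set X) : U `<=` U' -> near_sets U V -> near_sets U' V.
  by move=> /setUidPr <- UV; apply/(proxU ax); left.
move=> AA' BB' /(mono _ _ _ AA') /(prox_sym ax) /(mono _ _ _ BB').
exact: (prox_sym ax).
Qed.

Lemma far_subsetC A B : ~ near_sets A B -> A `<=` ~` B.
Proof.
move=> AB x Ax Bx; apply/AB/(prox_meet (near_sets_axioms X)).
by move=> AB0; have : (A `&` B) x by []; rewrite AB0.
Qed.

Lemma is_algebra_prox_algebra : is_algebra_of_sets (@prox_algebra X).
Proof.
have ax := near_sets_axioms X; split.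
- by move=> /(prox_neq0 ax)[_]; rewrite setCT.
- by move=> A farA /= /(prox_sym ax); rewrite setCK.
- move=> A B farA farB /= /(proxU ax)[] near.
  + by apply/farA/(near_setsS _ _ near) => //; apply/subsetC/subsetUl.
  + by apply/farB/(near_setsS _ _ near) => //; apply/subsetC/subsetUr.
Qed.

Definition prox_algebra_of_sets : algebra_of_sets :=
  AlgebraOfSets is_algebra_prox_algebra.

Lemma reduced_prox_algebra : zero_dimensional X -> reduced prox_algebra_of_sets.
Proof.
move=> Xzd x y xy; have ax := near_sets_axioms X.
have [C [xC yC CC]] : exists C : set X,
    [/\ ~ near_sets [set x] C, ~ near_sets [set y] (~` C) &
        ~ near_sets C (~` C)].
  by apply: Xzd => /(prox_separated ax).
exists (~` C); split; first exact: (algC is_algebra_prox_algebra).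
- exact: (far_subsetC xC).
- exact: (far_subsetC yC).
Qed.

Lemma algebra_near_prox_algebra : zero_dimensional X ->
  @algebra_near prox_algebra_of_sets = @near_sets X.
Proof.
move=> Xzd; apply: funext => A; apply: funext => B; apply: propext; split.
- apply: contra_notP => /Xzd[C [AC BC CC]].
  exists (~` C); split; first exact: (algC is_algebra_prox_algebra).
  + exact: far_subsetC.
  + exact: far_subsetC.
- by move=> AB [R [farR AR BR]]; apply: farR; exact: near_setsS AB.
Qed.

Lemma sigma_algebra_prox_algebra : P_aleph1 X ->
  sigma_algebra setT (@prox_algebra X).
Proof.
move=> XP; have alg := is_algebra_prox_algebra; split.
- by rewrite -setCT; exact: (algC alg (algT alg)).
- by move=> A farA; rewrite setTD; exact: (algC alg).
- move=> A farA /= /XP[n near]; apply/(farA n)/(near_setsS _ _ near) => //.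
  exact/subsetC/bigcup_sup.
Qed.

(** If [A] is far from [B], interpolation inserts [A'] far from [B] such that
    [A] is far from the complement of [A']. Iterating it from [A] gives a chain
    whose union [U] is still far from [B] by countable additivity; as each term
    is far from the complement of the next one, hence from that of [U], so is
    [U] itself. *)
Lemma P_aleph1_zero_dimensional : P_aleph1 X -> zero_dimensional X.
Proof.
move=> XP A B AB; have ax := near_sets_axioms X.
have /choice[next nextP] (S : {S : set X | ~ near_sets S B}) :
    exists S' : {S : set X | ~ near_sets S B},
      ~ near_sets (sval S) (~` (sval S')).
  have [E [SE EB]] := prox_between ax (svalP S).
  by exists (exist (fun S => ~ near_sets S B) (~` E) EB) => /=; rewrite setCK.
pose chain n := iter n next (exist (fun S => ~ near_sets S B) A AB).
pose U := \bigcup_n sval (chain n).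
have chain_far n : ~ near_sets (sval (chain n)) (~` U).
  move=> near; apply: (nextP (chain n)); apply: near_setsS near => //.
  exact/subsetC/(@bigcup_sup _ _ n.+1).
(* [U] surrounds [A], whereas the witness has to be far from [A]. *)
exists (~` U); rewrite setCK; split.
- exact: (chain_far 0).
- by move=> /(prox_sym ax)/XP[n]; exact: (svalP (chain n)).
- by move=> /(prox_sym ax)/XP[n]; exact: chain_far.
Qed.

End Proximity.

Section Algebra.
Variable X : algebra_of_sets.
Implicit Types A B R : set X.

Lemma far_algebra_nearP A B : ~ algebra_near A B <->
  exists R, [/\ alg_sets R, A `<=` R & B `<=` ~` R].
Proof. by split=> [/contrapT|near /(_ near)]. Qed.

Lemma is_separated_proximity_algebra_near : reduced X ->
  is_separated_proximity (@algebra_near X).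
Proof.
move=> Xred; have alg := alg_sets_axioms X.
have sep R A B : alg_sets R -> A `<=` R -> B `<=` ~` R -> ~ algebra_near A B.
  by move=> MR AR BR; apply/far_algebra_nearP; exists R.
have M0 : alg_sets (set0 : set X).
  by rewrite -setCT; exact: (algC alg (algT alg)).
split.
- move=> A B AB [R [MR BR AR]]; apply: (sep (~` R) _ _ _ AR _ AB).
  + exact: (algC alg).
  + by rewrite setCK.
- move=> A B C; split.
  + apply: contraPP => /not_orP[].
    move=> /far_algebra_nearP[R [MR AR CR]] /far_algebra_nearP[S [MS BS CS]].
    apply: (sep (R `|` S)); [exact: (algU alg)|exact: setUSS|].
    by rewrite setCU subsetI.
  + move=> near [R [MR ABR CR]]; move: ABR near.
    rewrite subUset => -[AR BR][] near.
    * exact: (sep R A C).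
    * exact: (sep R B C).
- move=> A B AB; split => E0; move: AB; rewrite E0.
  + by apply: (sep set0) => //; rewrite setC0.
  + by apply: (sep setT) => //; exact: (algT alg).
- move=> A B /far_algebra_nearP[R [MR AR BR]].
  by exists (~` R); rewrite setCK; split; exact: (sep R).
- move=> A B AB0 [R [_ AR BR]]; apply: AB0.
  by apply/seteqP; split=> // x [/AR Rx /BR].
- move=> x y; apply: contraPP => /Xred[R [MR Rx Ry]].
  by apply: (sep R) => // _ ->.
Qed.

Definition algebra_proximity (Xred : reduced X) : proximity_space :=
  ProximitySpace (is_separated_proximity_algebra_near Xred).

Lemma zero_dimensional_algebra_near (Xred : reduced X) :
  zero_dimensional (algebra_proximity Xred).
Proof.
move=> A B /far_algebra_nearP[R [MR AR BR]]; have alg := alg_sets_axioms X.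
have MR' := algC alg MR.
exists (~` R); rewrite setCK; split; apply/far_algebra_nearP.
- by exists R; split.
- by exists (~` R); split=> //; rewrite setCK.
- by exists (~` R); split=> //; rewrite setCK.
Qed.

Lemma prox_algebra_algebra_near (Xred : reduced X) :
  @prox_algebra (algebra_proximity Xred) = @alg_sets X.
Proof.
apply/seteqP; split=> R.
- move=> /far_algebra_nearP[S [MS RS RS']].
  by have -> : R = S by apply/seteqP; split=> //; rewrite -setCS.
- by move=> MR; apply: (far_algebra_nearP R (~` R)).2; exists R; split.
Qed.

Lemma P_aleph1_algebra_near (Xred : reduced X) :
  sigma_algebra setT (@alg_sets X) -> P_aleph1 (algebra_proximity Xred).
Proof.
case=> _ _ Mbigcup A B; apply: contraPP => /forallNP far.
have /choice[R RP] n :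
    exists R, [/\ alg_sets R, A n `<=` R & B `<=` ~` R].
  exact/far_algebra_nearP/far.
apply/far_algebra_nearP; exists (\bigcup_n R n); split.
- by apply: Mbigcup => n; have [] := RP n.
- by apply: subset_bigcup => n _; have [] := RP n.
- by move=> x Bx [n _]; have [_ _ /(_ x Bx)] := RP n.
Qed.

End Algebra.

(** * The two functors *)

Lemma proximity_map_measurable (X Y : proximity_space) (f : X -> Y) :
  proximity_map f ->
  @measurable_map (prox_algebra_of_sets X) (prox_algebra_of_sets Y) f.
Proof.
move=> fP R farR /fP near; apply/farR/(near_setsS _ _ near).
- exact: image_preimage_subset.
- by rewrite preimage_setC; exact: image_preimage_subset.
Qed.

Lemma measurable_map_proximity (X Y : algebra_of_sets) (f : X -> Y)
    (Xred : reduced X) (Yred : reduced Y) :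
  measurable_map f ->
  @proximity_map (algebra_proximity Xred) (algebra_proximity Yred) f.
Proof.
move=> fM A B AB [R [MR AR BR]]; apply: AB; exists (f @^-1` R).
by split; [exact: fM|rewrite -image_sub|rewrite preimage_setC -image_sub].
Qed.

(** Transparent, as is the functor in the other direction: the carriers have to
    be preserved by computation for the round trips on objects to reduce to
    equalities between families of sets or relations on the same type. *)
Definition prox_to_algebra :
  functor zd_proximity_category reduced_algebra_category.
Proof.
refine (@Functor zd_proximity_category reduced_algebra_category
  (fun X => exist reduced (prox_algebra_of_sets (sval X))
              (reduced_prox_algebra (svalP X)))
  (fun X Y f => exist _ (sval f) (proximity_map_measurable (svalP f))) _ _).
- by move=> X; exact: sval_inj.
- by move=> X Y Z g f; exact: sval_inj.
Defined.

Definition algebra_to_prox :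
  functor reduced_algebra_category zd_proximity_category.
Proof.
refine (@Functor reduced_algebra_category zd_proximity_category
  (fun X => exist zero_dimensional (algebra_proximity (svalP X))
              (zero_dimensional_algebra_near (Xred := svalP X)))
  (fun X Y f => exist _ (sval f)
     (measurable_map_proximity (Xred := svalP X) (Yred := svalP Y)
        (svalP f))) _ _).
- by move=> X; exact: sval_inj.
- by move=> X Y Z g f; exact: sval_inj.
Defined.

Lemma is_prox_to_algebra_prox_to_algebra : is_prox_to_algebra prox_to_algebra.
Proof.
split; last exact: functor_graph_inj.
by move=> X; exists (is_algebra_prox_algebra (sval X)).
Qed.

Lemma is_algebra_to_prox_algebra_to_prox : is_algebra_to_prox algebra_to_prox.
Proof.
split; last exact: functor_graph_inj.
by move=> X; exists (is_separated_proximity_algebra_near (svalP X)).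
Qed.

Lemma zd_underlying_faithful : faithful zd_underlying.
Proof. by move=> X Y f g; exact: sval_inj. Qed.

Lemma ra_underlying_faithful : faithful ra_underlying.
Proof. by move=> X Y f g; exact: sval_inj. Qed.

Lemma proximity_space_eq (T : Type) (d d' : set T -> set T -> Prop) dP d'P :
  d = d' -> ProximitySpace (near_sets := d) dP =
            ProximitySpace (near_sets := d') d'P.
Proof.
by move=> dd'; subst d'; congr ProximitySpace; exact: Prop_irrelevance.
Qed.

Lemma algebra_of_sets_eq (T : Type) (M M' : set (set T)) MP M'P :
  M = M' -> AlgebraOfSets (alg_sets := M) MP =
            AlgebraOfSets (alg_sets := M') M'P.
Proof.
by move=> MM'; subst M'; congr AlgebraOfSets; exact: Prop_irrelevance.
Qed.

Lemma inverse_prox_algebra : inverse_functors prox_to_algebra algebra_to_prox.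
Proof.
have [_ raF] := is_prox_to_algebra_prox_to_algebra.
have [_ zdG] := is_algebra_to_prox_algebra_to_prox.
split.
- apply: (functor_eq_faithful zd_underlying_faithful).
  + move=> [[T d dP] Xzd]; apply: sval_inj; apply: proximity_space_eq.
    exact: (algebra_near_prox_algebra Xzd).
  + by rewrite functor_compA zdG raF functor_comp1.
- apply: (functor_eq_faithful ra_underlying_faithful).
  + move=> [[T M MP] Xred]; apply: sval_inj; apply: algebra_of_sets_eq.
    exact: prox_algebra_algebra_near.
  + by rewrite functor_compA raF zdG functor_comp1.
Qed.

Lemma reduced_sigma_prox_to_algebra (X : zd_proximity_category) :
  P_aleph1 (sval X) -> reduced_sigma (sval (prox_to_algebra X)).
Proof.
move=> XP; split; first exact: (svalP (prox_to_algebra X)).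
exact: sigma_algebra_prox_algebra.
Qed.

Lemma P_aleph1_algebra_to_prox (X : reduced_algebra_category) :
  reduced_sigma (sval X) -> P_aleph1 (sval (algebra_to_prox X)).
Proof. by case=> _; exact: P_aleph1_algebra_near. Qed.

Theorem corollary2p5 :
  exists (F : functor zd_proximity_category reduced_algebra_category)
         (G : functor reduced_algebra_category zd_proximity_category),
    (is_prox_to_algebra F /\ is_algebra_to_prox G /\ inverse_functors F G)
    /\
    exists (PZ : forall X, P_aleph1 X -> zero_dimensional X)
           (SR : forall X, reduced_sigma X -> reduced X)
           (F' : functor P_aleph1_category reduced_sigma_category)
           (G' : functor reduced_sigma_category P_aleph1_category),
      let inclP : functor P_aleph1_category zd_proximity_category :=
        @full_subcategory_sub proximity_category _ _ PZ in
      let inclS : functor reduced_sigma_category reduced_algebra_category :=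
        @full_subcategory_sub algebra_category _ _ SR in
      functor_comp inclS F' = functor_comp F inclP /\
      functor_comp inclP G' = functor_comp G inclS /\
      inverse_functors F' G'.
Proof.
have [GF FG] := inverse_prox_algebra.
pose PZ := P_aleph1_zero_dimensional.
pose SR (X : algebra_category) (XS : reduced_sigma X) : reduced X := XS.1.
exists prox_to_algebra, algebra_to_prox; split.
  split; first exact: is_prox_to_algebra_prox_to_algebra.
  by split; first exact: is_algebra_to_prox_algebra_to_prox.
exists PZ, SR.
exists (@restrict_functor proximity_category algebra_category _ _ _ _
          PZ _ reduced_sigma_prox_to_algebra).
exists (@restrict_functor algebra_category proximity_category _ _ _ _
          SR _ P_aleph1_algebra_to_prox).
split; first exact: restrict_functorE.
split; first exact: restrict_functorE.
by split; exact: restrict_functorK.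
Qed.
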